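(* Let $C, D, t_0 \in \mathbb{C}$ be arbitrary, let $b\in\mathbb{C}$ with $|b|=1$, let $\eta=\log(b(t-t_0))$ (principal branch), with branch cut $\{t_0-\bar b p : p\ge 0\}$, and let $P_m,Q_m,R_m$ be the polynomials (depending on $D$) defined in the context. Then there exists $r>0$ (in general depending on both $C$ and $D$) such that, for every open neighborhood $U$ of the branch cut, the psi series $$x(t)=\sum_{m=-1}^{\infty}P_m(\eta+C)(t-t_0)^m,\quad y(t)=\sum_{m=-2}^{\infty}Q_m(\eta+C)(t-t_0)^m,\quad z(t)=\sum_{m=-2}^{\infty}R_m(\eta+C)(t-t_0)^m$$ converge uniformly and absolutely on $\{t : |t-t_0|\le r\}\setminus U$.
   Context: Throughout, $\log$ is the principal branch. Fix $D\in\mathbb{C}$. Polynomials $P_m$ ($m\ge -1$), $Q_m$, $R_m$ ($m\ge -2$) in one variable $u$ (to be evaluated at $u=\eta+C$) are defined as follows. Initial values: $Q_{-2}=-\frac{i}{5}$, $R_{-2}=-\frac15$; $P_{-1}=2i$, $Q_{-1}=2i$, $R_{-1}=\frac{17}{9}$; $P_0=\frac{71}{9}i$, $Q_0=-\frac{349}{81}i-\frac{988}{81}iu$, $R_0=\frac{1385}{54}-\frac{988}{81}u$; $P_1=-\frac{9880}{81}iu$, $Q_1=-\frac{25991}{108}i+\frac{64220}{243}iu$, $R_1=-\frac{211189}{972}+\frac{167960}{729}u$; $P_2=-\frac{2108195}{972}i+\frac{469300}{243}iu$, $Q_2=\frac{3}{10}iD-\frac{477319147}{131220}i-\frac{167831753}{65610}iu-\frac{273676}{2187}iu^2$,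 $R_2=-\frac15D+\frac{138959125}{17496}-\frac{58846039}{32805}u-\frac{1444456}{2187}u^2$; $P_3=iD-\frac{96356411}{6561}iu-\frac{2736760}{6561}iu^2$. For $m\ge 3$, the triple $X_m=(P_{m+1},Q_m,R_m)^T$ is defined recursively by $$X_m=-\sum_{j=0}^{\lfloor (m+2)/2\rfloor}A_m^{-j-1}\frac{d^jF_m}{du^j},$$ where $$A_m=\begin{pmatrix}-m-1&10&0\\ \frac15&-m&-2i\\ -\frac i5&2i&-m\end{pmatrix},\qquad F_m=\begin{pmatrix}-10P_m\\ 28P_{m-1}-Q_{m-1}-\sum_{j=0}^mP_jR_{m-j-1}\\ -\frac83R_{m-1}+\sum_{j=0}^mP_jQ_{m-j-1}\end{pmatrix}.$$ ($A_m$ has eigenvalues $-m+2,-m,-m-3$, so it is invertible for $m\ge3$; $X_m$ is the polynomial solution of $X_m'=A_mX_m+F_m$.) *)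

(* Defs.v *)
From Stdlib Require Import BinPosDef.
From mathcomp Require Import all_boot all_order all_algebra.
From mathcomp Require Import all_classical all_reals all_analysis.
From mathcomp Require Import complex zify.

Set Implicit Arguments.
Unset Strict Implicit.
Unset Printing Implicit Defensive.

Import Order.TTheory GRing.Theory Num.Theory.
Import numFieldNormedType.Exports.

Local Open Scope classical_set_scope.
Local Open Scope ring_scope.
Local Open Scope complex_scope.

(* The field [R[i]] carries its topology, uniform structure and norm through
   the alias [R[i]^o]; its norm and order are [R[i]]-valued, a real number [x]
   being embedded as [x%:C]. *)

(* Argument in (-pi, pi]; [carg 0] is a junk value. *)
Definition carg (R : realType) (z : R[i]) : R :=
  let a := acos (complex.Re z / ComplexField.Normc.normc z) in
  if 0 <= complex.Im z then a else - a.

Definition clog (R : realType) (z : R[i]) : R[i] :=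
  ln (ComplexField.Normc.normc z) +i* carg z.

Lemma clogP (R : realType) (z : R[i]) : z != 0 ->
  let w := clog z in
  z = (expR (complex.Re w))%:C * (cos (complex.Im w) +i* sin (complex.Im w))
  /\ - pi < complex.Im w <= pi.
Proof.
case: z => a b z0; rewrite /clog /carg /=.
set r := Num.sqrt _.
have s0 : 0 < a ^+ 2 + b ^+ 2.
  rewrite lt0r addr_ge0 ?sqr_ge0// andbT paddr_eq0 ?sqr_ge0// !sqrf_eq0.
  by move: z0; apply: contra => /andP[/eqP-> /eqP->].
have r0 : 0 < r by rewrite sqrtr_gt0.
have rn0 : r != 0 by rewrite gt_eqF.
have r2 : r ^+ 2 = a ^+ 2 + b ^+ 2 by rewrite sqr_sqrtr ?ltW.
have hc : -1 <= a / r <= 1.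
  rewrite -ler_norml normrM normfV (gtr0_norm r0) ler_pdivrMr// mul1r.
  by rewrite -sqrtr_sqr ler_wsqrtr// lerDl sqr_ge0.
have mulRC (x y y' : R) : x%:C * (y +i* y') = (x * y) +i* (x * y').
  by rewrite {1}/GRing.mul /= !mul0r subr0 addr0.
rewrite lnK ?posrE// mulRC.
have hca : cos (acos (a / r)) = a / r by rewrite acosK// in_itv.
have hsa : sin (acos (a / r)) = `|b| / r.
  rewrite sin_acos// -[RHS]ger0_norm ?divr_ge0 ?(ltW r0)//.
  rewrite -sqrtr_sqr !expr_div_n real_normK ?num_real//; congr Num.sqrt.
  apply: (mulIf (expf_neq0 2 rn0)); rewrite mulrBl !divfK ?expf_neq0//.
  by rewrite r2 mul1r addrAC subrr add0r.
have [b0|b0] := leP 0 b.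
  rewrite hca hsa ger0_norm// ![r * _]mulrC !divfK//; split=> //.
  by rewrite acos_lepi// andbT (lt_le_trans _ (acos_ge0 hc))// oppr_lt0 pi_gt0.
rewrite cosN sinN hca hsa ltr0_norm// mulrN mulNr mulrN opprK.
rewrite ![r * _]mulrC !divfK//; split=> //.
rewrite ltrN2 (le_trans _ (pi_ge0 R)) ?oppr_le0 ?acos_ge0// andbT.
rewrite acos_ltpi//; move/andP: hc => [hc1 ->]; rewrite andbT lt_neqAle hc1 andbT.
apply/eqP => hb; move: hsa; rewrite -hb acosN1 sinpi => /esym/eqP.
by rewrite mulf_eq0 normr_eq0 invr_eq0 (lt_eqF b0) (negbTE rn0).
Qed.

(* Coefficients with large numerators and denominators are entered through
   binary integers: ring literals are unary. *)
Fixpoint pos_ring (K : nzRingType) (p : positive) : K :=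
  match p with
  | xH => 1
  | xO q => pos_ring K q + pos_ring K q
  | xI q => pos_ring K q + pos_ring K q + 1
  end.

Definition frac (K : fieldType) (a b : positive) : K :=
  pos_ring K a / pos_ring K b.

Section Coefficients.
Variables (R : realType) (D : R[i]).

Notation q a b := (frac R[i] a%positive b%positive).
Notation qi a b := (frac R[i] a%positive b%positive * 'i%C).

Definition col3 (p1 p2 p3 : {poly R[i]}) : 'cV[{poly R[i]}]_3 :=
  \col_(k < 3) [:: p1; p2; p3]`_k.

(* The triples X_m = (P_(m+1), Q_m, R_m) for m = -2, -1, 0, 1, 2. *)
Definition X_init : seq 'cV[{poly R[i]}]_3 :=
  [:: col3 (qi 2 1)%:P
           (- qi 1 5)%:P
           (- q 1 5)%:P;
      col3 (qi 71 9)%:P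
           (qi 2 1)%:P
           (q 17 9)%:P;
      col3 (- qi 9880 81 *: 'X)
           ((- qi 349 81)%:P - qi 988 81 *: 'X)
           ((q 1385 54)%:P - q 988 81 *: 'X);
      col3 ((- qi 2108195 972)%:P + qi 469300 243 *: 'X)
           ((- qi 25991 108)%:P + qi 64220 243 *: 'X)
           ((- q 211189 972)%:P + q 167960 729 *: 'X);
      col3 (('i%C * D)%:P - qi 96356411 6561 *: 'X - qi 2736760 6561 *: 'X^2)
           ((qi 3 10 * D - qi 477319147 131220)%:P
            - qi 167831753 65610 *: 'X - qi 273676 2187 *: 'X^2)
           ((- q 1 5 * D + q 138959125 17496)%:P
            - q 58846039 32805 *: 'X - q 1444456 2187 *: 'X^2)].

(* [s] lists X_(-2), X_(-1), ..., so that P_m (m >= -1) is read off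
   X_(m-1) = s_(m+1), and Q_m, R_m (m >= -2) off X_m = s_(m+2). *)
Definition getP (s : seq 'cV[{poly R[i]}]_3) (m : int) : {poly R[i]} :=
  (s`_(absz (m + 1))) (inord 0) 0.
Definition getQ (s : seq 'cV[{poly R[i]}]_3) (m : int) : {poly R[i]} :=
  (s`_(absz (m + 2))) (inord 1) 0.
Definition getR (s : seq 'cV[{poly R[i]}]_3) (m : int) : {poly R[i]} :=
  (s`_(absz (m + 2))) (inord 2) 0.

Definition A_mx (m : nat) : 'M[R[i]]_3 :=
  \matrix_(k < 3, l < 3)
    (nth [::] [:: [:: - m%:R - 1; 10     ; 0         ];
         [:: 5^-1      ; - m%:R ; - (2 * 'i%C)];
         [:: - ('i%C / 5); 2 * 'i%C; - m%:R    ]] k)`_l.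

Definition F_vec (P Q S : int -> {poly R[i]}) (m : nat) : 'cV[{poly R[i]}]_3 :=
  let n := m%:Z in
  col3 (- 10 *: P n)
       (28 *: P (n - 1) - Q (n - 1)
        - \sum_(0 <= j < m.+1) P j%:Z * S (n - j%:Z - 1))
       (- (8 / 3) *: S (n - 1)
        + \sum_(0 <= j < m.+1) P j%:Z * Q (n - j%:Z - 1)).

Definition X_next (P Q S : int -> {poly R[i]}) (m : nat) : 'cV[{poly R[i]}]_3 :=
  - \sum_(0 <= j < (m + 2)./2.+1)
      map_mx polyC (A_mx m ^- j.+1) *m
      map_mx (derivn j) (F_vec P Q S m).

(* [X_list n] lists X_m for m = -2, ..., n + 2; the entry appended at stage
   [n.+1] is X_(n+3), computed from the previous ones. *)
Fixpoint X_list (n : nat) : seq 'cV[{poly R[i]}]_3 :=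
  if n is n'.+1 then
    let s := X_list n' in rcons s (X_next (getP s) (getQ s) (getR s) n'.+3)
  else X_init.

Definition psiP (m : int) : {poly R[i]} := getP (X_list (absz m)) m.
Definition psiQ (m : int) : {poly R[i]} := getQ (X_list (absz m)) m.
Definition psiR (m : int) : {poly R[i]} := getR (X_list (absz m)) m.

End Coefficients.

Lemma size_X_list (R : realType) (D : R[i]) n : size (X_list D n) = (n + 5)%N.
Proof. by elim: n => //= n IH; rewrite size_rcons IH. Qed.

Lemma nth_X_list (R : realType) (D : R[i]) n n' k :
  (k < n + 5)%N -> (k < n' + 5)%N -> (X_list D n)`_k = (X_list D n')`_k.
Proof.
wlog le_nn' : n n' / (n <= n')%N.
  move=> H h h'; have [/H|/ltnW/H->//] := leqP n n'; exact.
move=> h _; elim: n' le_nn' => [|n' IH]; first by rewrite leqn0 => /eqP->.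
rewrite leq_eqVlt => /predU1P[->//|/[!ltnS] nn']; rewrite IH//=.
by rewrite nth_rcons size_X_list (leq_trans h)// leq_add2r.
Qed.

Lemma psi_recurrence (R : realType) (D : R[i]) (m : nat) : (3 <= m)%N ->
  col3 (psiP D m.+1%:Z) (psiQ D m%:Z) (psiR D m%:Z)
  = X_next (psiP D) (psiQ D) (psiR D) m.
Proof.
case: m => [|[|[|n]]]// _.
set s := X_list D n.
have eP (k : int) : (-1 <= k <= n.+3%:Z) -> getP s k = psiP D k.
  move=> hk; rewrite /psiP /getP; congr (fun_of_matrix _ (inord 0) 0).
  by apply: nth_X_list; case: k hk => k; lia.
have eQ (k : int) : (-2 <= k < n.+3%:Z) -> getQ s k = psiQ D k.
  move=> hk; rewrite /psiQ /getQ; congr (fun_of_matrix _ (inord 1) 0).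
  by apply: nth_X_list; case: k hk => k; lia.
have eR (k : int) : (-2 <= k < n.+3%:Z) -> getR s k = psiR D k.
  move=> hk; rewrite /psiR /getR; congr (fun_of_matrix _ (inord 2) 0).
  by apply: nth_X_list; case: k hk => k; lia.
have -> : X_next (psiP D) (psiQ D) (psiR D) n.+3
        = X_next (getP s) (getQ s) (getR s) n.+3.
  rewrite /X_next; congr (- _); apply: eq_bigr => j _; congr (_ *m map_mx _ _).
  rewrite /F_vec; congr col3.
  - by rewrite eP//; lia.
  - rewrite eP ?eQ; [|lia..]; congr (_ - _).
    by apply: eq_big_nat => k hk; rewrite eP ?eR//; lia.
  - rewrite eR; last lia; congr (_ + _).
    by apply: eq_big_nat => k hk; rewrite eP ?eQ//; lia.
have eX N : (n < N)%N -> (X_list D N)`_(n + 5) = X_next (getP s) (getQ s) (getR s) n.+3.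
  move=> nN; rewrite (@nth_X_list _ _ _ n.+1); [|lia..].
  by rewrite /= nth_rcons size_X_list ltnn eqxx.
rewrite /psiP /psiQ /psiR /getP /getQ /getR.
have -> : absz (n.+4%:Z + 1) = (n + 5)%N by lia.
have -> : absz (n.+3%:Z + 2) = (n + 5)%N by lia.
rewrite !eX ?absz_nat; [|lia..].
apply/colP => -[[|[|[|k]]] hk]//; rewrite mxE /=;
  by congr (X_next _ _ _ _ _ _); apply/val_inj; rewrite /= inordK.
Qed.

(* [k]-th term of the series sum_(m >= - a) W_m(eta + C) (t - t0)^m, that is
   the one of index m = k - a, where eta = log(b(t - t0)). *)
Definition psi_term (R : realType) (a : nat) (W : int -> {poly R[i]})
    (C t0 b : R[i]) (k : nat) (t : R[i]^o) : R[i]^o :=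
  let m := k%:Z - a%:Z in
  (W m).[clog (b * (t - t0)) + C] * (t - t0) ^ m.

Definition branch_cut (R : realType) (t0 b : R[i]) : set R[i]^o :=
  [set t | exists2 p : R, 0 <= p & t = t0 - b^*%C * p%:C].

Definition cvg_uniform_absolute (R : realType) (K : set R[i]^o)
    (u : nat -> R[i]^o -> R[i]^o) : Prop :=
  (exists f : R[i]^o -> R[i]^o,
    {uniform K, (fun n t => series (u ^~ t) n) @ \oo --> f}) /\
  (forall t, K t -> cvgn [normed series (u ^~ t)]).

(* Main.v *)
Require Import Defs.
From mathcomp Require Import all_boot all_order all_algebra.
From mathcomp Require Import all_classical all_reals all_analysis.
From mathcomp Require Import complex ring lra zify.

Import Order.TTheory GRing.Theory Num.Theory.
Import numFieldNormedType.Exports.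

Local Open Scope classical_set_scope.
Local Open Scope ring_scope.
Local Open Scope complex_scope.

(** Measure a polynomial by |p|_s = sum_i |p_i| s^i, which is submultiplicative
and satisfies |p'|_s <= (deg p / s) |p|_s.  The triple of index k = m + 2 has
degree at most k/2, and A_m^-1 has norm at most c/k (A_m + m does not depend on
m and is annihilated by x(x - 2)(x + 3)); so for s >= c the sum over j defining
X_m is dominated by a geometric series and, for k >= 5, x_k = |X_(k-2)|_s satisfies
  x_k <= (2c/k) (14 x_(k-1) + 28 x_(k-2) + 2 sum_(0 < i < k) x_i x_(k-i)).
The k terms of the convolution are compensated by the factor 1/k, whence
x_k <= a (Lam sqrt s)^k with a, Lam independent of s.  At a point with
tau = t - t0 one takes s = c0 / |tau| >= |log(b tau) + C|: then
(Lam sqrt s |tau|)^2 = Lam^2 c0 |tau| <= 1/4 for |tau| <= r := 1/(4 Lam^2 c0), so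
the k-th term is O(2^-k), uniformly as long as t stays away from t0. *)

Set Implicit Arguments.
Unset Strict Implicit.

(** * Weighted sums of coefficient moduli of polynomials *)

Section ModulusSum.
Context {R : realType}.
Implicit Types (s : R) (p q : {poly R[i]}) (z w : R[i]).

(** A modulus with values in [R], since [|z|] itself lies in [R[i]]; all estimates are then real
    inequalities. *)
Definition cmod z : R := ComplexField.Normc.normc z.

Lemma normrC_cmod z : `|z| = (cmod z)%:C.
Proof. by []. Qed.

Lemma cmod_ge0 z : 0 <= cmod z.
Proof. by case: z => x y; apply: sqrtr_ge0. Qed.

Lemma cmod0 : cmod 0 = 0.
Proof. exact: ComplexField.Normc.normc0. Qed.

Lemma cmod1 : cmod 1 = 1.
Proof. exact: ComplexField.Normc.normc1. Qed.

Lemma cmodN z : cmod (- z) = cmod z.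
Proof. exact: normcN. Qed.

Lemma cmodD z w : cmod (z + w) <= cmod z + cmod w.
Proof. exact: le_normcD. Qed.

Lemma cmodM z w : cmod (z * w) = cmod z * cmod w.
Proof. exact: ComplexField.Normc.normcM. Qed.

Lemma cmodV z : cmod z^-1 = (cmod z)^-1.
Proof. exact: ComplexField.Normc.normcV. Qed.

Lemma cmodX z n : cmod (z ^+ n) = cmod z ^+ n.
Proof. by elim: n => [|n IH]; rewrite ?expr0 ?cmod1// !exprS cmodM IH. Qed.

Lemma cmod_nat n : cmod n%:R = n%:R.
Proof. by rewrite /cmod normcMn ComplexField.Normc.normc1. Qed.

Lemma cmod_real (x : R) : 0 <= x -> cmod x%:C = x.
Proof. by move=> x0; rewrite /cmod /= expr0n addr0 sqrtr_sqr ger0_norm. Qed.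

Lemma cmod_sum (I : Type) (r : seq I) (P : pred I) (f : I -> R[i]) :
  cmod (\sum_(i <- r | P i) f i) <= \sum_(i <- r | P i) cmod (f i).
Proof.
elim/big_rec2: _ => [|i x y _ h]; first by rewrite cmod0.
by rewrite (le_trans (cmodD _ _))// lerD2l.
Qed.

Definition absp p : {poly R} := map_poly cmod p.

Lemma coef_absp p i : (absp p)`_i = cmod p`_i.
Proof. by rewrite coef_map_id0 ?cmod0. Qed.

Lemma size_absp p : (size (absp p) <= size p)%N.
Proof. exact: size_poly. Qed.

Lemma le_horner (f g : {poly R}) s : 0 <= s ->
  (forall i, f`_i <= g`_i) -> f.[s] <= g.[s].
Proof.
move=> s0 h; set n := maxn (size f) (size g).
rewrite (@horner_coef_wide _ n f) ?leq_maxl//.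
rewrite (@horner_coef_wide _ n g) ?leq_maxr//.
by apply: ler_sum => i _; rewrite ler_wpM2r ?exprn_ge0.
Qed.

(** Encoded as a value of the polynomial of coefficient moduli, so that norm inequalities reduce to
    coefficientwise ones by [le_horner]. *)
Definition pnorm s p : R := (absp p).[s].

Lemma pnorm_ge0 s p : 0 <= s -> 0 <= pnorm s p.
Proof.
move=> s0; rewrite -(horner0 s) le_horner// => i.
by rewrite coef0 coef_absp cmod_ge0.
Qed.

Lemma pnorm0 s : pnorm s 0 = 0.
Proof. by rewrite /pnorm /absp map_poly0 horner0. Qed.

Lemma pnormN s p : pnorm s (- p) = pnorm s p.
Proof.
congr (_.[s]); apply/polyP => i.
by rewrite !coef_absp coefN cmodN.
Qed.

Lemma pnormD s p q : 0 <= s -> pnorm s (p + q) <= pnorm s p + pnorm s q.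
Proof.
move=> s0; rewrite -hornerD le_horner// => i.
by rewrite coefD !coef_absp coefD cmodD.
Qed.

Lemma pnorm_sum s (I : Type) (r : seq I) (P : pred I) (f : I -> {poly R[i]}) :
  0 <= s ->
  pnorm s (\sum_(i <- r | P i) f i) <= \sum_(i <- r | P i) pnorm s (f i).
Proof.
move=> s0; elim/big_rec2: _ => [|i x y _ h]; first by rewrite pnorm0.
by rewrite (le_trans (pnormD _ _ _))// lerD2l.
Qed.

Lemma pnormM s p q : 0 <= s -> pnorm s (p * q) <= pnorm s p * pnorm s q.
Proof.
move=> s0; rewrite -hornerM le_horner// => i.
rewrite coef_absp !coefM (le_trans (cmod_sum _ _ _))//.
by apply: ler_sum => j _; rewrite !coef_absp cmodM.
Qed.

Lemma pnormC s z : pnorm s z%:P = cmod z.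
Proof.
rewrite /pnorm; have -> : absp z%:P = (cmod z)%:P; last exact: hornerC.
by apply/polyP => i; rewrite coef_absp !coefC; case: eqP; rewrite ?cmod0.
Qed.

Lemma pnormZ s z p : 0 <= s -> pnorm s (z *: p) <= cmod z * pnorm s p.
Proof. by move=> s0; rewrite -mul_polyC -(pnormC s) pnormM. Qed.

(** After multiplication by s, this compares X |p'| with d |p| coefficientwise: i |p_i| <= d |p_i|,
    because p_i = 0 for i > d. *)
Lemma pnorm_deriv s p (d : nat) : 0 < s -> (size p <= d.+1)%N ->
  pnorm s p^`() <= d%:R / s * pnorm s p.
Proof.
move=> s0 sp; rewrite mulrAC ler_pdivlMr//.
rewrite /pnorm -hornerMX -hornerZ; apply: le_horner => [|[|i]]; first exact: ltW.
  by rewrite coefMX coefZ /= coef_absp mulr_ge0 ?cmod_ge0 ?ler0n.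
rewrite coefMX coefZ /= !coef_absp coef_deriv -[_ *+ i.+1]mulr_natl.
rewrite cmodM cmod_nat.
have [|hi] := leqP (size p) i.+1.
  by move=> /(nth_default 0)->; rewrite cmod0 !mulr0.
by rewrite ler_wpM2r ?cmod_ge0// ler_nat -ltnS (leq_trans hi).
Qed.

Lemma pnorm_derivn s p (d j : nat) : 0 < s -> (size p <= d.+1)%N ->
  pnorm s p^`(j) <= (d%:R / s) ^+ j * pnorm s p.
Proof.
move=> s0 sp; elim: j => [|j IH]; first by rewrite expr0 mul1r derivn0.
have sj : (size p^`(j) <= d.+1)%N.
  elim: j {IH} => [//|j IH]; rewrite derivnS.
  by rewrite (leq_trans (size_poly _ _))// (leq_trans (leq_pred _)).
rewrite derivnS (le_trans (pnorm_deriv s0 sj))// exprS -[leRHS]mulrA.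
by rewrite ler_wpM2l// divr_ge0// ltW.
Qed.

Lemma cmod_horner_le s p (u : R[i]) : cmod u <= s -> cmod p.[u] <= pnorm s p.
Proof.
move=> us; rewrite horner_coef (le_trans (cmod_sum _ _ _))//.
rewrite /pnorm (@horner_coef_wide _ (size p)) ?size_absp//.
apply: ler_sum => i _; rewrite coef_absp cmodM ler_wpM2l ?cmod_ge0//.
by rewrite cmodX lerXn2r ?nnegrE ?cmod_ge0// (le_trans (cmod_ge0 u)).
Qed.

Lemma pnorm_le_exp s p (d : nat) : 1 <= s -> (size p <= d.+1)%N ->
  pnorm s p <= pnorm 1 p * s ^+ d.
Proof.
move=> s1 sp; have s0 : 0 <= s by rewrite (le_trans ler01).
rewrite /pnorm !(@horner_coef_wide _ d.+1 (absp p)) ?(leq_trans (size_absp _))//.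
rewrite mulr_suml; apply: ler_sum => i _.
rewrite coef_absp expr1n mulr1 ler_wpM2l ?cmod_ge0//.
by rewrite ler_weXn2l// -ltnS.
Qed.

End ModulusSum.

Arguments cmod {R} z : simpl never.

(** * Entrywise sum norm of polynomial matrices *)

Section MatrixNorm.
Context {R : realType}.
Implicit Types (s : R).

(** Summing over all entries gives a norm that is submultiplicative for rectangular shapes too, so
    it serves both A_m^-1 and the columns X_m. *)
Definition mnorm s m n (M : 'M[{poly R[i]}]_(m, n)) : R :=
  \sum_i \sum_j pnorm s (M i j).

Lemma mnorm_ge0 s m n (M : 'M[{poly R[i]}]_(m, n)) : 0 <= s -> 0 <= mnorm s M.
Proof. by move=> s0; do 2 apply: sumr_ge0 => ? _; apply: pnorm_ge0. Qed.

Lemma pnorm_le_mnorm s m n (M : 'M[{poly R[i]}]_(m, n)) i j : 0 <= s ->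
  pnorm s (M i j) <= mnorm s M.
Proof.
move=> s0; rewrite /mnorm (bigD1 i)//= (bigD1 j)//= -addrA lerDl.
by rewrite addr_ge0// !sumr_ge0// => *; rewrite ?sumr_ge0// => *; apply: pnorm_ge0.
Qed.

Lemma mnormD s m n (M N : 'M[{poly R[i]}]_(m, n)) : 0 <= s ->
  mnorm s (M + N) <= mnorm s M + mnorm s N.
Proof.
move=> s0; rewrite /mnorm -big_split/=; apply: ler_sum => i _.
by rewrite -big_split/=; apply: ler_sum => j _; rewrite mxE pnormD.
Qed.

Lemma mnormN s m n (M : 'M[{poly R[i]}]_(m, n)) : mnorm s (- M) = mnorm s M.
Proof. by apply: eq_bigr => i _; apply: eq_bigr => j _; rewrite mxE pnormN. Qed.

Lemma mnorm_sum s m n (I : Type) (r : seq I) (P : pred I)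
    (f : I -> 'M[{poly R[i]}]_(m, n)) : 0 <= s ->
  mnorm s (\sum_(i <- r | P i) f i) <= \sum_(i <- r | P i) mnorm s (f i).
Proof.
move=> s0; elim/big_rec2: _ => [|i x y _ h].
  by rewrite /mnorm big1// => i _; rewrite big1// => j _; rewrite mxE pnorm0.
by rewrite (le_trans (mnormD _ _ _))// lerD2l.
Qed.

Lemma mnormZ s m n (z : {poly R[i]}) (M : 'M[{poly R[i]}]_(m, n)) : 0 <= s ->
  mnorm s (z *: M) <= pnorm s z * mnorm s M.
Proof.
move=> s0; rewrite mulr_sumr; apply: ler_sum => i _.
by rewrite mulr_sumr; apply: ler_sum => j _; rewrite mxE pnormM.
Qed.

Lemma mnormM s m n p (M : 'M[{poly R[i]}]_(m, n)) (N : 'M[{poly R[i]}]_(n, p)) :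
  0 <= s -> mnorm s (M *m N) <= mnorm s M * mnorm s N.
Proof.
move=> s0; rewrite mulr_suml; apply: ler_sum => i _.
apply: (@le_trans _ _ (\sum_k \sum_j pnorm s (M i j) * pnorm s (N j k))).
  apply: ler_sum => k _; rewrite mxE (le_trans (pnorm_sum _ _ _ _))//.
  by apply: ler_sum => j _; apply: pnormM.
rewrite exchange_big/= mulr_suml; apply: ler_sum => j _.
rewrite -mulr_sumr ler_wpM2l ?pnorm_ge0//.
rewrite [leRHS](bigD1 j)//= lerDl.
by do 2 apply: sumr_ge0 => ? _; apply: pnorm_ge0.
Qed.

(** The exponent is positive because the identity has norm n + 1, not 1. *)
Lemma mnormX s n (M : 'M[{poly R[i]}]_n.+1) k : 0 <= s ->
  mnorm s (M ^+ k.+1) <= mnorm s M ^+ k.+1.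
Proof.
move=> s0; elim: k => [|k IH]; first by rewrite !expr1.
rewrite exprS [leRHS]exprS (le_trans (mnormM _ _ s0))// ler_wpM2l//.
exact: mnorm_ge0.
Qed.

Lemma mnorm_polyC s m n (M : 'M[R[i]]_(m, n)) :
  mnorm s (map_mx polyC M) = \sum_i \sum_j cmod (M i j).
Proof. by apply: eq_bigr => i _; apply: eq_bigr => j _; rewrite mxE pnormC. Qed.

Lemma mnorm_derivn s m n (M : 'M[{poly R[i]}]_(m, n)) (d j : nat) : 0 < s ->
  (forall i k, size (M i k) <= d.+1)%N ->
  mnorm s (map_mx (derivn j) M) <= (d%:R / s) ^+ j * mnorm s M.
Proof.
move=> s0 sM; rewrite mulr_sumr; apply: ler_sum => i _.
by rewrite mulr_sumr; apply: ler_sum => k _; rewrite mxE pnorm_derivn.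
Qed.

Lemma mnorm_le_exp s m n (M : 'M[{poly R[i]}]_(m, n)) (d : nat) : 1 <= s ->
  (forall i k, size (M i k) <= d.+1)%N ->
  mnorm s M <= mnorm 1 M * s ^+ d.
Proof.
move=> s1 sM; rewrite mulr_suml; apply: ler_sum => i _.
by rewrite mulr_suml; apply: ler_sum => k _; apply: pnorm_le_exp.
Qed.

End MatrixNorm.

(** * Inverse of A_m and its decay in m *)

Section Resolvent.
Variable R : realType.
Local Notation B := (A_mx R 0).

Lemma A_mxE m : A_mx R m = B - m%:R.
Proof.
rewrite -(rmorph_nat (@scalar_mx _ _)) /=.
apply/matrixP => i j; rewrite !mxE.
by case: i => -[|[|[|]]]// ?; case: j => -[|[|[|]]]// ?;
   rewrite /= ?mulr1n ?mulr0n ?subr0 ?oppr0 ?add0r // addrC.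
Qed.

(* The eigenvalues of [B] are 2, 0 and -3. *)
Lemma A_mx0_cube : B ^+ 3 = 6%:R * B - B ^+ 2.
Proof.
have i2 : ('i%C : R[i]) * 'i%C = - 1 by rewrite -expr2 sqr_i.
rewrite !exprS expr0 mulr1 mulr_natl.
apply/matrixP => k l; rewrite !mxE !big_ord_recl !big_ord0 !mxE.
rewrite !big_ord_recl !big_ord0 !mxE.
case: k => -[|[|[|]]]// ?; case: l => -[|[|[|]]]// ?; rewrite /=;
  move: ('i%C : R[i]) i2 => i i2; by field: i2.
Qed.
(** With q(x) = x(x - 2)(x + 3) = x^3 + x^2 - 6x one has q(B) = 0, so -q(m) = q(B) - q(m) = (B -
    m)(B^2 + (m + 1)B + m^2 + m - 6), and q(m) is nonzero for m >= 3. *)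
Lemma A_mx_inv m : (3 <= m)%N ->
  (A_mx R m)^-1 =
  - ((m * (m - 2) * (m + 3))%:R^-1 *:
      ((m ^ 2 + m - 6)%:R%:M + m.+1%:R *: B + B *m B)).
Proof.
move=> m3; set V := RHS.
suff VA : V * A_mx R m = 1.
  have /andP[_ uA] : (V \in unitmx) && (A_mx R m \in unitmx).
    by apply/andP; apply: mulmx1_unit.
  by rewrite -[RHS](mulrK uA) VA mul1r.
have m0 : (m * (m - 2) * (m + 3))%:R != 0 :> R[i] by rewrite pnatr_eq0; lia.
rewrite A_mxE /V mulNr -scalerAl; apply: (canLR opprK).
apply: (scalerI m0); rewrite scalerA divff// scale1r.
have e6 : ((m ^ 2 + m - 6)%:R : R[i]) = m%:R ^+ 2 + m%:R - 6.
  rewrite natrB; last by nia.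
  by rewrite natrD natrX.
have ek : ((m * (m - 2) * (m + 3))%:R : R[i]) = m%:R * (m%:R - 2) * (m%:R + 3).
  by rewrite !natrM natrD natrB//; lia.
rewrite -(rmorph_nat (@scalar_mx _ _)) /= e6 ek -[m.+1%:R]natr1.
move: (m%:R : R[i]) => x.
have h := A_mx0_cube.
rewrite mulrBr !mulrDl -scalerAl -!mulmxE.
rewrite mul_scalar_mx !mul_mx_scalar.
have -> : B *m B *m B = B *+ 6 - B *m B by rewrite !mulmxE -expr2 -exprSr h mulr_natl.
move: (B *m B) => B2.
apply/matrixP => i j; rewrite !mxE.
by case: (i == j); rewrite ?mulr1n ?mulr0n; ring.
Qed.

(** The constant c of the overview; 3 is the norm of the identity. *)
Definition res_bound : R :=
  let beta := \sum_i \sum_j cmod (B i j) in 2 * (3 + beta + beta ^+ 2).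

Lemma res_bound_ge6 : 6 <= res_bound.
Proof.
rewrite /res_bound; set b := \sum_i _.
have b0 : 0 <= b by rewrite /b; do 2 apply: sumr_ge0 => ? _; apply: cmod_ge0.
by nra.
Qed.

(** Put Q = (m - 2)(m + 3) = m^2 + m - 6. As Q >= m + 1 and Q >= 1, the numerator in [A_mx_inv] has
    norm at most Q(3 + b + b^2); Q cancels against the denominator m Q, and 1/m <= 2/(m + 2). *)
Lemma mnorm_A_mx_inv s m : 0 <= s -> (3 <= m)%N ->
  mnorm s (map_mx polyC (A_mx R m)^-1) <= res_bound / (m + 2)%:R.
Proof.
move=> s0 m3.
rewrite A_mx_inv// map_mxN mnormN map_mxZ !map_mxD map_scalar_mx map_mxZ map_mxM /=.
set BP := map_mx polyC B.
set b : R := \sum_i \sum_j cmod (B i j).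
have bE : mnorm s BP = b by rewrite mnorm_polyC.
have b0 : 0 <= b by rewrite -bE mnorm_ge0.
have e6 : ((m ^ 2 + m - 6)%:R : R) = m%:R ^+ 2 + m%:R - 6.
  rewrite natrB; last by nia.
  by rewrite natrD natrX.
have h : mnorm s ((m ^ 2 + m - 6)%:R%:P%:M + m.+1%:R%:P *: BP + BP *m BP) <=
   (m%:R ^+ 2 + m%:R - 6) * 3 + m.+1%:R * b + b ^+ 2.
  rewrite (le_trans (mnormD _ _ s0))// lerD//; last by rewrite -bE expr2 mnormM.
  rewrite (le_trans (mnormD _ _ s0))// lerD//.
    rewrite -map_scalar_mx mnorm_polyC -e6.
    rewrite !big_ord_recl !big_ord0 !mxE /= ?mulr0n ?mulr1n.
    by rewrite cmod_nat cmod0; rewrite le_eqVlt; apply/orP; left; apply/eqP; ring.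
  by rewrite (le_trans (mnormZ _ _ s0))// pnormC cmod_nat bE.
rewrite (le_trans (mnormZ _ _ s0))// pnormC cmodV cmod_nat.
have ek : ((m * (m - 2) * (m + 3))%:R : R) = m%:R * (m%:R - 2) * (m%:R + 3).
  by rewrite !natrM natrD natrB//; lia.
have k0 : 0 < ((m * (m - 2) * (m + 3))%:R : R) by rewrite ltr0n; lia.
rewrite mulrC ler_pdivrMr// mulrAC ler_pdivlMr; last by rewrite ltr0n addn2.
apply: (le_trans (ler_wpM2r _ h)); first exact: ler0n.
rewrite /res_bound -/b ek natrD -[m.+1%:R]natr1.
have x3 : 3 <= (m%:R : R) by rewrite ler_nat.
move: (m%:R : R) x3 => x x3.
have q0 : 0 <= (x - 2) * (x + 3) by nra.
have q1 : x + 1 <= (x - 2) * (x + 3) by nra.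
have q2 : 1 <= (x - 2) * (x + 3) by nra.
set Q := (x - 2) * (x + 3) in q0 q1 q2.
have -> : x ^+ 2 + x - 6 = Q by rewrite /Q; ring.
have -> : x * (x - 2) * (x + 3) = Q * x by rewrite /Q; ring.
have c1 : Q * 3 + (x + 1) * b + b ^+ 2 <= Q * (3 + b + b ^+ 2).
  have h1 := ler_wpM2r b0 q1.
  have h2 := ler_wpM2r (sqr_ge0 b) q2.
  by lra.
have c2 : x + 2 <= 2 * x by lra.
have -> : 2 * (3 + b + b ^+ 2) * (Q * x) = Q * (3 + b + b ^+ 2) * (2 * x) by ring.
apply: ler_pM => //; last by lra.
by rewrite !addr_ge0 ?mulr_ge0 ?sqr_ge0//; lra.
Qed.

End Resolvent.

(** * Degrees and norm recursion of the coefficient triples *)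

Section Coefficients.
Variables (R : realType) (D : R[i]).

(* Shifted index: [triple k] is X_(k-2) = (P_(k-1), Q_(k-2), R_(k-2)). *)
Definition triple (k : nat) : 'cV[{poly R[i]}]_3 := (X_list D k)`_k.

Lemma X_list_triple n k : (k < n + 5)%N -> (X_list D n)`_k = triple k.
Proof. by move=> h; apply: nth_X_list => //; lia. Qed.

Lemma psiP_triple k : psiP D (k%:Z - 1) = triple k (inord 0) 0.
Proof.
rewrite /psiP /getP X_list_triple; last by lia.
by congr (triple _ _ _); lia.
Qed.

Lemma psiQ_triple k : psiQ D (k%:Z - 2) = triple k (inord 1) 0.
Proof.
rewrite /psiQ /getQ X_list_triple; last by lia.
by congr (triple _ _ _); lia.
Qed.

Lemma psiR_triple k : psiR D (k%:Z - 2) = triple k (inord 2) 0.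
Proof.
rewrite /psiR /getR X_list_triple; last by lia.
by congr (triple _ _ _); lia.
Qed.

Lemma triple_rec m : (3 <= m)%N ->
  triple (m + 2) = X_next (psiP D) (psiQ D) (psiR D) m.
Proof.
move=> m3; rewrite -psi_recurrence//.
have -> : m.+1%:Z = (m + 2)%N%:Z - 1 by lia.
have -> : m%:Z = (m + 2)%N%:Z - 2 by lia.
rewrite psiP_triple psiQ_triple psiR_triple.
apply/colP => -[[|[|[|k]]] hk]//; rewrite !mxE /=;
  by congr (triple _ _ _); apply/val_inj; rewrite /= inordK.
Qed.

Lemma triple_init k : (k < 5)%N -> triple k = (X_init D)`_k.
Proof. by move=> k5; rewrite -(@X_list_triple 0). Qed.

Local Notation T k a := (triple k (inord a) 0).

(** In shifted indices the two factors of each product have positive indices with sum m + 2, the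
    index of the triple to be computed. *)
Lemma F_vec_triple m : F_vec (psiP D) (psiQ D) (psiR D) m =
  col3 (- 10 *: T m.+1 0)
       (28 *: T m 0 - T m.+1 1
        - \sum_(0 <= j < m.+1) T j.+1 0 * T (m - j).+1 2)
       (- (8 / 3) *: T m.+1 2
        + \sum_(0 <= j < m.+1) T j.+1 0 * T (m - j).+1 1).
Proof.
rewrite /F_vec -!psiP_triple -!psiQ_triple -!psiR_triple.
congr col3.
- by congr (_ *: psiP D _); lia.
- congr (_ - _).
  apply: eq_big_nat => j hj; rewrite -psiP_triple -psiR_triple.
  by congr (psiP D _ * psiR D _); lia.
- congr (_ + _).
  apply: eq_big_nat => j hj; rewrite -psiP_triple -psiQ_triple.
  by congr (psiP D _ * psiQ D _); lia.
Qed.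

(** Products are controlled by floor((j + 1)/2) + floor((m - j + 1)/2) <= floor((m + 2)/2); linear
    combinations stay in the submodule [poly_of_size n]. *)
Lemma size_F_vec m i :
  (forall k j, (k < m + 2)%N -> (size (triple k j 0%R) <= k./2.+1)%N) ->
  (size (F_vec (psiP D) (psiQ D) (psiR D) m i 0%R) <= (m + 2)./2.+1)%N.
Proof.
move=> IH; set n := (m + 2)./2.+1.
have hT k a : (k < m + 2)%N -> T k a \is a poly_of_size n.
  by move=> km; rewrite qualifE/= (leq_trans (IH _ _ km))//; rewrite /n; lia.
have hM j a b : (j < m.+1)%N -> T j.+1 a * T (m - j).+1 b \is a poly_of_size n.
  move=> jm; rewrite qualifE/= (leq_trans (size_polyMleq _ _))//.
  have /(IH _ (inord a)) : (j.+1 < m + 2)%N by lia.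
  have /(IH _ (inord b)) : ((m - j).+1 < m + 2)%N by lia.
  rewrite /n. move: (size _) (size _) => p q; lia.
have hS a b : \sum_(0 <= j < m.+1) T j.+1 a * T (m - j).+1 b \is a poly_of_size n.
  by rewrite big_nat; apply: rpred_sum => j hj; apply: hM; lia.
rewrite -[(_ <= _)%N]/(_ \is a poly_of_size n) F_vec_triple.
case: i => -[|[|[|i]]]// hi; rewrite mxE /=.
- by rewrite rpredZ// hT//; lia.
- by rewrite !rpredB ?hS ?rpredZ ?hT//; lia.
- by rewrite rpredD ?hS ?rpredZ ?hT//; lia.
Qed.

(** Constant matrices and derivatives do not raise the degree of F; the first five triples are
    inspected entry by entry. *)
Lemma size_triple k i : (size (triple k i 0%R) <= k./2.+1)%N.
Proof.
elim/ltn_ind: k i => k IH i.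
rewrite -[(_ <= _)%N]/(_ \is a poly_of_size k./2.+1).
have [k5|k5] := ltnP k 5; last first.
  have km : k = (k - 2 + 2)%N by lia.
  have := @triple_rec (k - 2); rewrite -km => ->; last by lia.
  have sF l := @size_F_vec (k - 2) l
    (fun n j nk => IH n (leq_trans nk (eq_leq (esym km))) j).
  rewrite /X_next; move: (F_vec _ _ _ _) sF => F; rewrite -km => sF.
  rewrite mxE rpredN summxE; apply: rpred_sum => j _.
  rewrite mxE; apply: rpred_sum => l _; rewrite !mxE mul_polyC rpredZ//.
  apply: leq_trans (sF l); elim: j => [//|n]; rewrite derivnS; apply: leq_trans.
  by rewrite (leq_trans (size_poly _ _))// leq_pred.
have hC n (z : R[i]) : z%:P \is a poly_of_size n.+1.
  by rewrite qualifE/= (leq_trans (size_polyC_leq1 _)).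
have hX n : ('X : {poly R[i]}) \is a poly_of_size n.+2.
  by rewrite qualifE/= size_polyX.
have hX2 n : ('X^2 : {poly R[i]}) \is a poly_of_size n.+3.
  by rewrite qualifE/= size_polyXn.
rewrite triple_init//.
case: k k5 {IH} => [|[|[|[|[|k]]]]]// _; case: i => -[|[|[|i]]]// hi;
  by rewrite mxE [nth _ _ _]/= ?rpredD ?rpredB ?rpredN ?rpredZ ?hC ?hX ?hX2.
Qed.

Lemma mnorm_col3 s (p q r : {poly R[i]}) :
  mnorm s (col3 p q r) = pnorm s p + pnorm s q + pnorm s r.
Proof. by rewrite /mnorm !big_ord_recl !big_ord0 !mxE /= !addr0 addrA. Qed.

(** The 14 rounds up 10 + 1 + 8/3, and the factor 2 counts the two convolutions. *)
Lemma mnorm_F_vec s m : 0 <= s ->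
  mnorm s (F_vec (psiP D) (psiQ D) (psiR D) m) <=
    14 * mnorm s (triple m.+1) + 28 * mnorm s (triple m) +
    2 * \sum_(0 <= j < m.+1) mnorm s (triple j.+1) * mnorm s (triple (m - j).+1).
Proof.
move=> s0; rewrite F_vec_triple mnorm_col3.
have hT k a : pnorm s (T k a) <= mnorm s (triple k) by apply: pnorm_le_mnorm.
have hS a b : pnorm s (\sum_(0 <= j < m.+1) T j.+1 a * T (m - j).+1 b) <=
  \sum_(0 <= j < m.+1) mnorm s (triple j.+1) * mnorm s (triple (m - j).+1).
  rewrite (le_trans (pnorm_sum _ _ _ s0))//; apply: ler_sum => j _.
  by rewrite (le_trans (pnormM _ _ s0))// ler_pM ?pnorm_ge0.
have h1 : pnorm s (- 10 *: T m.+1 0) <= 10 * mnorm s (triple m.+1).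
  by rewrite (le_trans (pnormZ _ _ s0))// cmodN cmod_nat ler_wpM2l.
have h2 : pnorm s (28 *: T m 0) <= 28 * mnorm s (triple m).
  by rewrite (le_trans (pnormZ _ _ s0))// cmod_nat ler_wpM2l.
have h3 : pnorm s (- (8 / 3) *: T m.+1 2) <= 8 / 3 * mnorm s (triple m.+1).
  rewrite (le_trans (pnormZ _ _ s0))// cmodN cmodM cmodV !cmod_nat.
  by rewrite ler_wpM2l.
have h4 := pnormD (28 *: T m 0 - T m.+1 1)
  (- \sum_(0 <= j < m.+1) T j.+1 0 * T (m - j).+1 2) s0.
have h5 := pnormD (28 *: T m 0) (- T m.+1 1) s0.
have h6 := pnormD (- (8 / 3) *: T m.+1 2)
  (\sum_(0 <= j < m.+1) T j.+1 0 * T (m - j).+1 1) s0.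
rewrite !pnormN in h4 h5.
have := hS 0%N 2; have := hS 0%N 1%N; have := hT m.+1 1%N.
have := mnorm_ge0 (triple m.+1) s0.
by lra.
Qed.

(** With k = m + 2, term j is at most (c/k)^(j+1) (floor(k/2)/s)^j |F|. Since s >= c, successive
    bounds have ratio at most 1/2, and the geometric sum costs a factor 2. *)
Lemma mnorm_triple_rec s m : res_bound R <= s -> (3 <= m)%N ->
  mnorm s (triple (m + 2)) <=
    2 * res_bound R / (m + 2)%:R * mnorm s (F_vec (psiP D) (psiQ D) (psiR D) m).
Proof.
move=> cs m3; set F := F_vec _ _ _ _.
have s0 : 0 < s by rewrite (lt_le_trans _ cs)// (lt_le_trans _ (res_bound_ge6 R)).
have c0 : 0 <= res_bound R by rewrite (le_trans _ (res_bound_ge6 R)).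
have Ainv := mnorm_A_mx_inv (ltW s0) m3.
move: (res_bound R) cs c0 Ainv => c cs c0 Ainv.
have k0 : 0 < (m + 2)%:R :> R by rewrite ltr0n addn2.
have szF i l : (size (F i l) <= (m + 2)./2.+1)%N.
  by rewrite [l]ord1 size_F_vec// => *; apply: size_triple.
rewrite triple_rec// /X_next mnormN (le_trans (mnorm_sum _ _ _ (ltW s0)))//.
apply: (@le_trans _ _ (\sum_(0 <= j < (m + 2)./2.+1)
   (c / (m + 2)%:R * mnorm s F) * 2^-1 ^+ j)).
  apply: ler_sum => j _; rewrite (le_trans (mnormM _ _ (ltW s0)))//.
  apply: (@le_trans _ _ ((c / (m + 2)%:R) ^+ j.+1 *
     (((m + 2)./2%:R / s) ^+ j * mnorm s F))).
    apply: ler_pM; rewrite ?mnorm_ge0 ?(ltW s0)//; last exact: mnorm_derivn.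
    rewrite -exprVn rmorphXn (le_trans (mnormX _ _ (ltW s0)))//.
    rewrite lerXn2r ?nnegrE ?mnorm_ge0 ?(ltW s0)//.
      by rewrite divr_ge0 ?(ltW k0).
  rewrite exprS -!mulrA ler_wpM2l//.
  rewrite ler_wpM2l ?invr_ge0 ?(ltW k0)//.
  rewrite mulrA -exprMn mulrC ler_wpM2l ?mnorm_ge0 ?(ltW s0)//.
  have d0 : 0 <= (m + 2)./2%:R :> R by rewrite ler0n.
  have d1 : (m + 2)./2%:R * 2 <= (m + 2)%:R :> R.
    by rewrite -natrM ler_nat; lia.
  rewrite lerXn2r ?nnegrE ?mulr_ge0 ?divr_ge0 ?invr_ge0 ?(ltW s0) ?(ltW k0)//.
  rewrite mulrA ler_pdivrMr// mulrAC ler_pdivrMr//.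
  have := ler_wpM2l (ltW s0) d1; have := ler_wpM2l d0 cs.
  by lra.
rewrite -mulr_sumr [leRHS](_ : _ = c / (m + 2)%:R * mnorm s F * 2); last by ring.
rewrite ler_wpM2l//.
  by rewrite mulr_ge0 ?mnorm_ge0 ?(ltW s0)// divr_ge0 ?(ltW k0).
(* A geometric sum S <= 2 is followed by 1 + S/2 <= 2. *)
elim: (_./2) => [|n IH]; first by rewrite big_nat1 expr0 ler1n.
rewrite big_nat_recl//= expr0.
under eq_bigr do rewrite exprS.
by rewrite -mulr_sumr; lra.
Qed.

End Coefficients.

(** * Geometric growth of the triples by majorants *)

Section Growth.
Variables (R : realType) (D : R[i]).

(** Each half of a L^k pays for one kind of term. The linear ones give at most 84 c a L^(k-1), and L
    >= 168 c; the convolution gives at most 4 c a^2 L^k, and 8 c a = 1, the factor k - 1 being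
    absorbed by 1/k. *)
Lemma majorant_step (c a L Lam : R) (k : nat) : 0 <= c -> 0 < a -> 8 * c * a = 1 ->
  168 * c <= Lam -> 1 <= Lam -> Lam <= L -> (2 <= k)%N ->
  2 * c / k%:R * (14 * (a * L ^+ k.-1) + 28 * (a * L ^+ k.-2) +
    2 * (k.-1%:R * (a ^+ 2 * L ^+ k))) <= a * L ^+ k.
Proof.
move=> c0 a0 ca cLam Lam1 LamL; case: k => [|[|k]]// _ /=.
rewrite mulrAC ler_pdivrMr ?ltr0n// ![L ^+ _.+1]exprS.
set X := L ^+ k; set n : R := k.+2%:R.
have X0 : 0 <= X by rewrite exprn_ge0// (le_trans _ LamL)// (le_trans ler01).
have n2 : 1 <= n by rewrite ler1n.
have kn : k.+1%:R <= n by rewrite ler_nat.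
have k0 : 0 <= k.+1%:R :> R by rewrite ler0n.
have L1 : 1 <= L by apply: le_trans LamL.
move: (k.+1%:R) n n2 kn k0 => p n n2 kn k0; clearbody X.
have h1 : 14 * (a * (L * X)) + 28 * (a * X) <= 42 * (a * (L * X)).
  have : a * X <= a * (L * X) by rewrite ler_wpM2l ?(ltW a0)// ler_peMl.
  by lra.
have h2 : 2 * c * (42 * (a * (L * X))) <= 2^-1 * (a * (L * (L * X))).
  have : 168 * c * (a * (L * X)) <= L * (a * (L * X)).
    by rewrite ler_wpM2r ?(le_trans cLam)// !mulr_ge0// ?(ltW a0)// (le_trans ler01).
  by lra.
have Y0 : 0 <= a * (L * (L * X)).
  by rewrite !mulr_ge0// ?(ltW a0)// (le_trans ler01).
have h3 : 2 * c * (2 * (p * (a ^+ 2 * (L * (L * X))))) <=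
    2^-1 * n * (a * (L * (L * X))).
  have -> : 2 * c * (2 * (p * (a ^+ 2 * (L * (L * X))))) =
     2^-1 * (8 * c * a) * (p * (a * (L * (L * X)))) by field.
  rewrite ca; have := ler_wpM2r Y0 kn; lra.
have h4 := ler_wpM2r Y0 n2.
have h5 : 2 * c * (14 * (a * (L * X)) + 28 * (a * X)) <= 2 * c * (42 * (a * (L * X))).
  by rewrite ler_wpM2l// mulr_ge0.
rewrite mulrDr; apply: le_trans (lerD (le_trans h5 h2) h3) _.
by move: (a * (L * (L * X))) h4 => Y h4; lra.
Qed.

(** The degree is at most floor(k/2), and s^floor(k/2) <= sqrt(s)^k for s >= 1. The constant still
    depends on k; this starts the induction for k < 5. *)
Lemma mnorm_triple_le (s : R) k : 1 <= s ->
  mnorm s (triple D k) <= mnorm 1 (triple D k) * Num.sqrt s ^+ k.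
Proof.
move=> s1; have s0 : 0 <= s by rewrite (le_trans ler01).
apply: le_trans (mnorm_le_exp s1 (d := k./2) _) _.
  by move=> i l; rewrite [l]ord1 size_triple.
rewrite ler_wpM2l ?mnorm_ge0// -{1}(sqr_sqrtr s0) -exprM.
by apply: ler_weXn2l; [rewrite -sqrtr1 ler_wsqrtr|lia].
Qed.

Lemma triple_growth : exists a Lam : R, [/\ 0 < a, 1 <= Lam &
  forall s k, res_bound R <= s -> mnorm s (triple D k) <= a * (Lam * Num.sqrt s) ^+ k].
Proof.
move: (res_bound R) (res_bound_ge6 R) (@mnorm_triple_rec R D) => c c6 rec.
have c0 : 0 < c by rewrite (lt_le_trans _ c6).
pose a : R := (8 * c)^-1.
have a0 : 0 < a by rewrite invr_gt0 mulr_gt0.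
have ca : 8 * c * a = 1 by rewrite divff// mulf_neq0// gt_eqF.
pose S := \sum_(i < 5) mnorm 1 (triple D i).
have S0 : 0 <= S by apply: sumr_ge0 => i _; rewrite mnorm_ge0.
(* The first summand is what [majorant_step] requires; the second gives a Lam >= S, which covers the
   initial triples 1 to 4. *)
pose Lam := 168 * c + S / a.
have cLam : 168 * c <= Lam by rewrite lerDl divr_ge0// ltW.
have Lam1 : 1 <= Lam by rewrite (le_trans _ cLam)//; move: c6; clear; lra.
have Lam0 : 0 <= Lam by rewrite (le_trans ler01).
have SLam : S <= a * Lam.
  by rewrite /Lam mulrDr [a * (S / a)]mulrCA divff ?gt_eqF// mulr1 lerDr;
     apply: mulr_ge0 (ltW a0) (mulr_ge0 (ler0n _ 168) (ltW c0)).
have leS k : (k < 5)%N -> mnorm 1 (triple D k) <= S.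
  move=> k5; rewrite /S (bigD1 (Ordinal k5))//= lerDl.
  by apply: sumr_ge0 => i _; rewrite mnorm_ge0.
(* Index 0 carries no power of Lam, so S is added to a for its sake. The recursion involves positive
   indices only, where a itself suffices. *)
exists (a + S), Lam; split => // [|s]; first by rewrite ltr_pwDl.
suff main k : c <= s -> (0 < k)%N ->
    mnorm s (triple D k) <= a * (Lam * Num.sqrt s) ^+ k.
  move=> [|k] cs.
    have s1 : 1 <= s by rewrite (le_trans _ cs)// (le_trans _ c6)// ler1n.
    rewrite (le_trans (mnorm_triple_le 0 s1))// !expr0 !mulr1.
    by rewrite (le_trans (leS 0%N _))// lerDr ltW.
  apply: le_trans (main k.+1 cs _) _ => //.
  by rewrite ler_wpM2r ?lerDl// exprn_ge0// mulr_ge0// sqrtr_ge0.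
move=> cs; have s1 : 1 <= s by rewrite (le_trans _ cs)// (le_trans _ c6)// ler1n.
have s0 : 0 <= s by rewrite (le_trans ler01).
have q1 : 1 <= Num.sqrt s by rewrite -sqrtr1 ler_wsqrtr.
set L := Lam * Num.sqrt s.
have LamL : Lam <= L by rewrite ler_peMr.
have L0 : 0 <= L by rewrite (le_trans Lam0).
elim/ltn_ind: k => k IH k0.
have [k5|k5] := ltnP k 5.
  apply: le_trans (mnorm_triple_le k s1) _.
  rewrite exprMn mulrA ler_wpM2r ?exprn_ge0 ?sqrtr_ge0//.
  rewrite (le_trans (leS k k5))// (le_trans SLam)// ler_wpM2l// ?(ltW a0)//.
  by case: k k0 {IH k5} => [//|k] _; rewrite exprS ler_peMr// exprn_ege1.
have k2 : (2 <= k)%N by rewrite (leq_trans _ k5).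
have m3 : (3 <= k - 2)%N by rewrite leq_subRL.
have := rec s (k - 2)%N cs m3; rewrite subnK// => /le_trans; apply.
apply: le_trans (majorant_step (ltW c0) a0 ca cLam Lam1 LamL k2).
rewrite ler_wpM2l ?divr_ge0 ?mulr_ge0 ?(ltW c0)//.
apply: le_trans (mnorm_F_vec D (k - 2) s0) _.
have e1 : (k - 2).+1 = k.-1 by rewrite -subSn// subSS subn1.
have e2 : (k - 2)%N = k.-2 by rewrite subn2.
rewrite e1 e2.
have hk j : (0 < j < k)%N -> mnorm s (triple D j) <= a * L ^+ j.
  by move=> /andP[j0 jk]; apply: IH.
rewrite !lerD// ?ler_wpM2l//.
- by apply: hk; clear -k5; lia.
- by apply: hk; clear -k5; lia.
(* The two indices add up to k, so each of the k - 1 products is at most a^2 L^k. *)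
rewrite mulr_natl -[k.-1 in leRHS]subn0 -sumr_const_nat.
rewrite big_nat [leRHS]big_nat; apply: ler_sum => j hj.
have -> : a ^+ 2 * L ^+ k = (a * L ^+ j.+1) * (a * L ^+ (k.-2 - j).+1).
  have {1}-> : k = (j.+1 + (k.-2 - j).+1)%N by clear -k5 hj; lia.
  by rewrite exprD; ring.
by apply: ler_pM; rewrite ?mnorm_ge0 ?hk//; clear -k5 hj; lia.
Qed.

End Growth.

(** * Convergence of series dominated by M/2^k *)

Section Convergence.
Variable R : realType.

(* The limit is the common point of the nested intervals
   [S_n - 2M/2^n, S_n + 2M/2^n], with S_n the partial sums. *)
Lemma dyadic_series_lim (v : nat -> R) (M : R) :
  (forall k, `|v k| <= M * 2^-1 ^+ k) ->
  exists l, forall n, `|\sum_(0 <= k < n) v k - l| <= 2 * M * 2^-1 ^+ n.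
Proof.
move=> hv.
pose lo n := \sum_(0 <= k < n) v k - 2 * M * 2^-1 ^+ n.
pose hi n := \sum_(0 <= k < n) v k + 2 * M * 2^-1 ^+ n.
have M0 : 0 <= M by have := hv 0%N; rewrite expr0 mulr1; apply: le_trans.
have lo_nd : nondecreasing_seq lo.
  apply/nondecreasing_seqP => n; rewrite /lo big_nat_recr//= exprS.
  by have := hv n; rewrite ler_norml => /andP[h _]; lra.
have hi_ni : nonincreasing_seq hi.
  apply/nonincreasing_seqP => n; rewrite /hi big_nat_recr//= exprS.
  by have := hv n; rewrite ler_norml => /andP[_ h]; lra.
have lohi n m : lo n <= hi m.
  apply: (@le_trans _ _ (lo (maxn n m))); first by rewrite lo_nd// leq_maxl.
  apply: (@le_trans _ _ (hi (maxn n m))); last by rewrite hi_ni// leq_maxr.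
  rewrite /lo /hi; have : 0 <= 2 * M * 2^-1 ^+ maxn n m by rewrite !mulr_ge0// exprn_ge0.
  lra.
exists (sup (range lo)) => n; rewrite ler_norml; apply/andP; split.
  have : sup (range lo) <= hi n.
    by apply: ge_sup; [exists (lo 0%N), 0%N|move=> _ [m _ <-]].
  by rewrite /hi; lra.
have : lo n <= sup (range lo).
  apply: ub_le_sup; last by exists n.
  by exists (hi 0%N) => _ [m _ <-].
by rewrite /lo; lra.
Qed.

Lemma Re_le_cmod (z : R[i]) : `|complex.Re z| <= cmod z.
Proof.
case: z => x y /=; rewrite /cmod /= -sqrtr_sqr ler_wsqrtr//.
by rewrite lerDl sqr_ge0.
Qed.

Lemma Im_le_cmod (z : R[i]) : `|complex.Im z| <= cmod z.
Proof.
case: z => x y /=; rewrite /cmod /= -sqrtr_sqr ler_wsqrtr//.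
by rewrite lerDr sqr_ge0.
Qed.

Lemma cmod_le_ReIm (x y : R) : cmod (x +i* y) <= `|x| + `|y|.
Proof.
have -> : x +i* y = x +i* 0 + 0 +i* y.
  by apply/eqP; rewrite eq_complex /= addr0 add0r !eqxx.
apply: le_trans (cmodD _ _) _.
by rewrite /cmod /= !expr0n /= addr0 add0r !sqrtr_sqr.
Qed.

(** Real and imaginary parts obey the same majorant, and their errors 2M/2^n add up. *)
Lemma dyadic_cseries_lim (u : nat -> R[i]) (M : R) :
  (forall k, cmod (u k) <= M * 2^-1 ^+ k) ->
  exists l, forall n, cmod (series u n - l) <= 4 * M * 2^-1 ^+ n.
Proof.
move=> hu.
have [x hx] : exists l, forall n,
    `|\sum_(0 <= k < n) complex.Re (u k) - l| <= 2 * M * 2^-1 ^+ n.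
  by apply: dyadic_series_lim => k; apply: le_trans (Re_le_cmod _) (hu k).
have [y hy] : exists l, forall n,
    `|\sum_(0 <= k < n) complex.Im (u k) - l| <= 2 * M * 2^-1 ^+ n.
  by apply: dyadic_series_lim => k; apply: le_trans (Im_le_cmod _) (hu k).
exists (x +i* y) => n.
have -> : series u n - x +i* y =
    (\sum_(0 <= k < n) complex.Re (u k) - x) +i*
    (\sum_(0 <= k < n) complex.Im (u k) - y).
  rewrite /series /=; elim: n => [|n IH]; first by rewrite !big_nil.
  rewrite !big_nat_recr//= addrAC IH; case: (u n) => a b.
  by apply/eqP; rewrite eq_complex /=; apply/andP; split; apply/eqP; ring.
by apply: le_trans (cmod_le_ReIm _ _) _; have := hx n; have := hy n; lra.
Qed.

Lemma dyadic_small (M e : R) : 0 < e ->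
  exists N, forall n, (N <= n)%N -> M * 2^-1 ^+ n < e.
Proof.
move=> e0; exists (Num.bound (`|M| / e)) => n hn.
apply: le_lt_trans (ler_wpM2r _ (ler_norm M)) _; first by rewrite exprn_ge0.
rewrite exprVn ltr_pdivrMr ?exprn_gt0// mulrC -ltr_pdivrMr//.
apply: lt_le_trans (archi_boundP _) _; first by rewrite divr_ge0// ltW.
by rewrite -natrX ler_nat (leq_trans hn)// ltnW// ltn_expl.
Qed.

(** Radii of balls lie in [R[i]]; a positive one is real, so the comparison can be made in [R]. *)
Lemma ball_cmod (x y e : R[i]^o) : 0 < e ->
  cmod (x - y) < complex.Re e -> ball x e y.
Proof.
move=> e0 h; rewrite -ball_normE /=.
by rewrite normrC_cmod -[e]RRe_real ?ger0_real ?ltW// ltcR.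
Qed.

Lemma gt0_Re (e : R[i]) : 0 < e -> 0 < complex.Re e.
Proof. by rewrite ltcE => /andP[]. Qed.

(** The error bound 4M/2^n does not depend on t, hence uniformity. *)
Lemma dyadic_cvg_uniform_absolute (K : set R[i]^o) (u : nat -> R[i]^o -> R[i]^o)
    (M : R) :
  (forall t, K t -> forall k, cmod (u k t) <= M * 2^-1 ^+ k) ->
  cvg_uniform_absolute K u.
Proof.
move=> hu; split.
  have : forall t, exists l : R[i]^o, K t ->
      forall n, cmod (series (u ^~ t) n - l) <= 4 * M * 2^-1 ^+ n.
    (* Off K the limit function gets the default value 0. *)
    move=> t; have [Kt|nK] := pselect (K t); last by exists 0.
    by have [l hl] := dyadic_cseries_lim (hu t Kt); exists l.
  move=> /choice[f hf]; exists f => P /uniform_nbhs[E [entE EP]].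
  move: entE; rewrite -entourage_from_ballE => -[e /= e0 eE].
  have [N hN] := dyadic_small (4 * M) (gt0_Re e0).
  exists N => // n /= Nn; apply: EP => t Kt; apply: eE => /=.
  apply: ball_cmod => //; rewrite -cmodN opprB.
  exact: le_lt_trans (hf t Kt n) (hN n Nn).
move=> t Kt.
(* The moduli, seen in [R[i]], have the same majorant, so the complex lemma applies again. *)
have [l hl] : exists l, forall n,
    cmod (series (fun k => `|u k t| : R[i]) n - l) <= 4 * M * 2^-1 ^+ n.
  apply: dyadic_cseries_lim => k; rewrite normrC_cmod cmod_real ?cmod_ge0//.
  exact: hu.
apply/cvg_ex; exists (l : R[i]^o); apply/cvg_ballP => e e0.
have [N hN] := dyadic_small (4 * M) (gt0_Re e0).
exists N => // n /= Nn; apply: ball_cmod => //; rewrite -cmodN opprB.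
exact: le_lt_trans (hl n) (hN n Nn).
Qed.

End Convergence.

(** * Estimate of the psi series terms and conclusion *)

Section Main.
Variable R : realType.

(** For |z| <= 1, the real part has modulus ln(1/|z|) <= 1/|z|, and the argument is at most pi <=
    pi/|z| in modulus. *)
Lemma cmod_clog_le (z : R[i]) : z != 0 -> cmod z <= 1 ->
  cmod (clog z) <= (1 + pi) / cmod z.
Proof.
move=> z0 z1.
have r0 : 0 < cmod z.
  rewrite lt_neqAle cmod_ge0 andbT eq_sym; apply: contra z0 => /eqP h.
  by rewrite (ComplexField.Normc.eq0_normc h).
have [_] := clogP z0.
rewrite /clog -[ComplexField.Normc.normc z]/(cmod z) => /= /andP[arg1 arg2].
apply: le_trans (cmod_le_ReIm _ _) _; rewrite mulrDl lerD//.
  rewrite ler0_norm; last by rewrite ln_le0.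
  by rewrite -lnV ?posrE// div1r ltW// ln_sublinear// invr_gt0.
apply: (@le_trans _ _ pi); first by rewrite ler_norml (ltW arg1).
by rewrite ler_peMr ?pi_ge0// invf_ge1.
Qed.

(** One estimate for all three series: (a, i) is (1, 0) for P, (2, 1) for Q and (2, 2) for R. The
    factor eps^-a bounds the power tau^-a coming from the index shift. *)
Lemma psi_term_le (a : nat) (W : int -> {poly R[i]}) (i : 'I_3) (D C t0 b : R[i])
    (al Lam r eps : R) (t : R[i]^o) k :
  (forall k, W (k%:Z - a%:Z) = triple D k i 0) -> `|b| = 1 ->
  0 < al -> 1 <= Lam ->
  (forall s k, res_bound R <= s ->
     mnorm s (triple D k) <= al * (Lam * Num.sqrt s) ^+ k) ->
  r = (4 * Lam ^+ 2 * (1 + pi + cmod C + res_bound R))^-1 ->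
  0 < eps -> eps <= cmod (t - t0) -> cmod (t - t0) <= r ->
  cmod (psi_term a W C t0 b k t) <= al * eps ^- a * 2^-1 ^+ k.
Proof.
move=> WE b1 al0 Lam1 grow rE eps0 epst tr.
have c6 := res_bound_ge6 R.
set tau := t - t0 in epst tr *.
have tau0 : 0 < cmod tau by apply: lt_le_trans epst.
have tau_neq0 : tau != 0 by apply: contraTneq tau0 => ->; rewrite cmod0 ltxx.
move: (res_bound R) c6 grow rE => c c6 grow rE.
have C0 := cmod_ge0 C; have pi0 := pi_ge0 R.
(* In s = c0/|tau|, the part 1 + pi pays for log(b tau), [cmod C] for C, and c ensures c <= s. *)
set c0 := 1 + pi + cmod C + c in rE.
have c01 : 1 <= c0 by rewrite /c0; lra.
have cc0 : c <= c0 by rewrite /c0; lra.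
have Lam21 : 1 <= Lam ^+ 2 by rewrite exprn_ege1.
have den : 1 <= 4 * Lam ^+ 2 * c0.
  by rewrite -mulrA mulr_ege1 ?mulr_ege1 ?ler1n.
have den0 : 0 < 4 * Lam ^+ 2 * c0 by apply: lt_le_trans den.
have tau1 : cmod tau <= 1 by rewrite (le_trans tr)// rE invf_le1.
have vtau1 : 1 <= (cmod tau)^-1 by rewrite invf_ge1.
have cb : cmod b = 1 by move: b1; rewrite normrC_cmod => -[].
have cw : cmod (b * tau) = cmod tau by rewrite cmodM cb mul1r.
have w0 : b * tau != 0.
  by rewrite mulf_neq0//; apply: contra_eq_neq cb => ->; rewrite cmod0 eq_sym oner_eq0.
pose s := c0 / cmod tau.
have s0 : 0 <= s by rewrite divr_ge0 ?cmod_ge0// (le_trans ler01).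
have cs : c <= s.
  by rewrite (le_trans cc0)// ler_peMr// (le_trans ler01).
have us : cmod (clog (b * tau) + C) <= s.
  apply: le_trans (cmodD _ _) _.
  have := cmod_clog_le w0; rewrite cw => /(_ tau1) h.
  have h2 : cmod C <= cmod C / cmod tau by rewrite ler_peMr.
  have h3 : 0 <= c / cmod tau by rewrite divr_ge0 ?cmod_ge0// (le_trans _ c6).
  by rewrite /s /c0 !mulrDl in h *; lra.
pose L := Lam * Num.sqrt s.
have Lam0 : 0 <= Lam by rewrite (le_trans ler01).
have L0 : 0 <= L by rewrite mulr_ge0 ?sqrtr_ge0.
(* Squaring removes the root: (L |tau|)^2 = Lam^2 c0 |tau| <= Lam^2 c0 r = 1/4. *)
have Ltau : L * cmod tau <= 2^-1.
  rewrite -(@ler_pXn2r _ 2)// ?nnegrE ?mulr_ge0 ?cmod_ge0//.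
  rewrite /L !exprMn sqr_sqrtr// /s.
  have -> : Lam ^+ 2 * (c0 / cmod tau) * cmod tau ^+ 2 = Lam ^+ 2 * c0 * cmod tau.
    by rewrite expr2; field; rewrite gt_eqF.
  apply: le_trans (ler_wpM2l _ tr) _.
    by rewrite mulr_ge0// (le_trans ler01).
  rewrite rE ler_pdivrMr// exprVn; lra.
have -> : psi_term a W C t0 b k t = (triple D k i 0).[clog (b * tau) + C] *
    (tau ^ k%:Z * tau ^ (- a%:Z)) by rewrite -expfzDr// -WE.
rewrite !cmodM.
have -> : cmod (tau ^ k%:Z) = cmod tau ^+ k by rewrite -cmodX.
have -> : cmod (tau ^ (- a%:Z)) = cmod tau ^- a.
  by rewrite -exprnN cmodV cmodX.
have h1 : cmod (triple D k i 0).[clog (b * tau) + C] <= al * L ^+ k.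
  apply: le_trans (cmod_horner_le _ us) _.
  by apply: le_trans (pnorm_le_mnorm _ _ _ s0) _; apply: grow.
apply: le_trans (ler_wpM2r _ h1) _.
  by rewrite mulr_ge0 ?invr_ge0 ?exprn_ge0 ?cmod_ge0.
have -> : al * L ^+ k * (cmod tau ^+ k / cmod tau ^+ a) =
    al * cmod tau ^- a * (L * cmod tau) ^+ k.
  by rewrite (exprMn _ L) -!mulrA; congr (_ * _); rewrite mulrA mulrC.
apply: ler_pM.
- by rewrite mulr_ge0 ?(ltW al0)// invr_ge0 exprn_ge0// cmod_ge0.
- by rewrite exprn_ge0// mulr_ge0// cmod_ge0.
- rewrite ler_wpM2l ?(ltW al0)// lef_pV2 ?posrE ?exprn_gt0//.
  by rewrite lerXn2r ?nnegrE ?(ltW eps0) ?(ltW tau0).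
- by rewrite lerXn2r ?nnegrE ?invr_ge0// mulr_ge0// cmod_ge0.
Qed.

End Main.

Unset Implicit Arguments.

Theorem theorem4p5 (R : realType) (C D t0 b : R[i]) (hb : `|b| = 1) :
  exists2 r : R, 0 < r &
    forall U : set R[i]^o, open U -> branch_cut t0 b `<=` U ->
      let K := [set t : R[i]^o | `|t - t0| <= r%:C] `\` U in
      [/\ cvg_uniform_absolute K (psi_term 1 (psiP D) C t0 b),
          cvg_uniform_absolute K (psi_term 2 (psiQ D) C t0 b) &
          cvg_uniform_absolute K (psi_term 2 (psiR D) C t0 b)].
Proof.
have [al [Lam [al0 Lam1 grow]]] := triple_growth D.
(* The radius depends on D through Lam and on C through [cmod C]. *)
pose r : R := (4 * Lam ^+ 2 * (1 + pi + cmod C + res_bound R))^-1.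
exists r.
  rewrite invr_gt0 !mulr_gt0// ?exprn_gt0 ?(lt_le_trans ltr01)//.
  by have := cmod_ge0 C; have := pi_ge0 R; have := res_bound_ge6 R; lra.
move=> U oU cutU K.
(* The point t0 is the end p = 0 of the cut, so the open set U contains a ball around it, which K
   avoids. *)
have [eps eps0 epsU] : exists2 eps : R, 0 < eps & forall t, K t -> eps <= cmod (t - t0).
  have : U t0 by apply: cutU; exists 0; rewrite ?mulr0 ?subr0.
  move=> /oU/nbhs_ballP[e /= e0 eU]; exists (complex.Re e); first exact: gt0_Re.
  move=> t [_ nUt]; rewrite leNgt; apply/negP => h; apply: nUt; apply: eU.
  by apply: ball_cmod => //; rewrite -cmodN opprB.
have conv a W i (WE : forall k, W (k%:Z - a%:Z) = triple D k i 0) :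
    cvg_uniform_absolute K (psi_term a W C t0 b).
  apply: (@dyadic_cvg_uniform_absolute _ _ _ (al * eps ^- a)) => t Kt k.
  apply: (psi_term_le k WE hb al0 Lam1 grow erefl eps0 (epsU t Kt)).
  by case: Kt => /= + _; rewrite normrC_cmod lecR.
by split; apply: conv => k; rewrite ?psiP_triple ?psiQ_triple ?psiR_triple.
Qed.
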